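(* Let $\sigma$ and $\tau=a_1a_2\cdots a_n$ be permutations such that $\sigma$ occurs exactly once in $\tau$ as a quasi-consecutive pattern. Then $\mu(\sigma,\tau)=0$, unless one of the following cases holds: (1) $\sigma=\tau$, in which case $\mu(\sigma,\tau)=1$; (2) $\sigma$ is covered by $\tau$, in which case $\mu(\sigma,\tau)=-1$; (3) $[\sigma,\tau]$ has rank $2$ and the occurrence of $\sigma$ uses position $1$ but not positions $2$ and $n$, in which case $\mu(\sigma,\tau)=1$; the same holds when the occurrence uses position $2$ but not positions $1$ and $n$; (4) $[\sigma,\tau]$ has rank $2$, the occurrence of $\sigma$ uses position $n$ but not positions $1$ and $2$, and $a_1,a_2$ are not consecutive integers (i.e. $|a_1-a_2|\neq1$), in which case $\mu(\sigma,\tau)=1$; (5) $[\sigma,\tau]$ has rank $3$, the occurrence of $\sigma$ uses position $n-1$ but not positions $1$, $2$, $n$, the occurrence is consecutive in $\tau$, and $\tau$ covers three distinct elements of $[\sigma,\tau]$, in which case $\mu(\sigma,\tau)=-1$.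
   Context: Permutations are written in one-line notation. For permutations $\sigma$ of length $m$ and $\tau=a_1a_2\cdots a_n$ of length $n$, an occurrence of $\sigma$ in $\tau$ (as a quasi-consecutive pattern) is a sequence of positions $1\le i_1<i_2<\cdots<i_m\le n$ such that $i_{j+1}=i_j+1$ for all $2\le j\le m-1$ and $a_{i_1}\cdots a_{i_m}$ is order-isomorphic to $\sigma$ (i.e. $a_{i_s}<a_{i_t}$ iff $\sigma_s<\sigma_t$); thus all entries of the occurrence are adjacent in $\tau$ except possibly the first and second. ''$\sigma$ occurs exactly once'' means there is exactly one such sequence of positions. The occurrence uses position $p$ if $p\in\{i_1,\dots,i_m\}$; it is consecutive if moreover $i_2=i_1+1$. The quasi-consecutive pattern poset is the set of all finite permutations ordered by $\sigma\le\tau$ iff $\tau$ contains an occurrence of $\sigma$. $\tau$ covers $\rho$ if $\rho<\tau$ and no $\alpha$ satisfies $\rho<\alpha<\tau$ (equivalently, $\rho\le\tau$ and $\rho$ has length one less than $\tau$). The interval $[\sigma,\tau]$ is $\{\rho:\sigma\le\rho\le\tau\}$, and its rank is $n-m$. $\mu$ is the Möbius function of this poset: $\mu(x,x)=1$ and $\mu(x,y)=-\sum_{x\le z<y}\mu(x,z)$ for $x<y$. *)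

(* Defs.v *)
From HB Require Import structures.
From mathcomp Require Import all_boot all_order all_algebra all_fingroup.

Set Implicit Arguments.
Unset Strict Implicit.
Unset Printing Implicit Defensive.

Import Order.Theory GRing.Theory.

(* Permutations of all finite lengths. The entries and the positions of       *)
(* p : qperm live in 'I_(plen p), hence are numbered from 0. The empty        *)
(* permutation is included as the least element; this does not affect the     *)
(* intervals [s, t] with s nonempty.                                          *)
Definition qperm : Type := {n : nat & 'S_n}.

HB.instance Definition _ :=
  Choice.on qperm.

Definition plen (p : qperm) : nat := tag p.
Definition pperm (p : qperm) : 'S_(plen p) := tagged p.
Definition mkqperm n (s : 'S_n) : qperm := Tagged (fun k => 'S_k) s.

(* The p-th letter a_p of the one-line notation a_1 a_2 ... a_n of t, with    *)
(* p and the letters numbered from 1 (0 if p is out of range).                *)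
Definition oneline (t : qperm) : seq nat :=
  [seq (pperm t i).+1 | i <- enum 'I_(plen t)].
Definition letter (t : qperm) (p : nat) : nat := nth 0 (0 :: oneline t) p.

(* A sequence of positions i_1, ..., i_m is encoded as the function f that    *)
(* sends the index j - 1 to the position i_j - 1. Under this shift, the       *)
(* condition 2 <= j <= m - 1 on adjacent entries becomes 1 <= j < m - 1.      *)
Definition is_occ m n (s : 'S_m) (t : 'S_n) (f : {ffun 'I_m -> 'I_n}) : bool :=
  [&& [forall j : 'I_m, forall k : 'I_m, (j < k) ==> (f j < f k)],
      [forall j : 'I_m, forall k : 'I_m,
         (0 < j) && (k == j.+1 :> nat) ==> (f k == (f j).+1 :> nat)] &
      [forall j : 'I_m, forall k : 'I_m,
         (t (f j) < t (f k)) == (s j < s k)]].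

Definition occurrences (s t : qperm) : {set {ffun 'I_(plen s) -> 'I_(plen t)}} :=
  [set f | is_occ (pperm s) (pperm t) f].

(* The position p is numbered from 1. *)
Definition uses_position m n (f : {ffun 'I_m -> 'I_n}) (p : nat) : bool :=
  [exists j : 'I_m, (f j).+1 == p].

(* For m <= 1 there is no second position and the condition is vacuous.       *)
Definition consecutive_occ m n (f : {ffun 'I_m -> 'I_n}) : bool :=
  [forall j : 'I_m, forall k : 'I_m,
     (j == 0 :> nat) && (k == 1 :> nat) ==> (f k == (f j).+1 :> nat)].

Definition qc_le (s t : qperm) : bool := occurrences s t != set0.

Lemma is_occP m n (s : 'S_m) (t : 'S_n) (f : {ffun 'I_m -> 'I_n}) :
  reflect [/\ forall j k : 'I_m, j < k -> f j < f k,
              forall j k : 'I_m, 0 < j -> k = j.+1 :> nat ->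
                f k = (f j).+1 :> nat &
              forall j k : 'I_m, (t (f j) < t (f k)) = (s j < s k)]
          (is_occ s t f).
Proof.
apply: (iffP and3P) => -[h1 h2 h3]; split.
- by move=> j k jk; have /forallP/(_ k)/implyP/(_ jk) := forallP h1 j.
- move=> j k j0 kj; apply/eqP.
  have /forallP/(_ k)/implyP := forallP h2 j.
  by apply; rewrite j0 kj eqxx.
- by move=> j k; have /forallP/(_ k)/eqP := forallP h3 j.
- by apply/forallP => j; apply/forallP => k; apply/implyP; exact: h1.
- apply/forallP => j; apply/forallP => k; apply/implyP => /andP[j0 /eqP kj].
  by apply/eqP; exact: h2.
- by apply/forallP => j; apply/forallP => k; apply/eqP.
Qed.

Lemma qc_leP (s t : qperm) :
  reflect (exists f, is_occ (pperm s) (pperm t) f) (qc_le s t).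
Proof.
by apply: (iffP (set0Pn _)) => -[f]; rewrite ?inE => hf; exists f; rewrite ?inE.
Qed.

Lemma qc_le_refl : reflexive qc_le.
Proof.
move=> s; apply/qc_leP; exists [ffun i => i]; apply/is_occP.
by split=> [j k|j k _|j k]; rewrite !ffunE.
Qed.

Lemma qc_le_trans : transitive qc_le.
Proof.
move=> r s t /qc_leP[f /is_occP[f1 f2 f3]] /qc_leP[g /is_occP[g1 g2 g3]].
apply/qc_leP; exists [ffun i => g (f i)]; apply/is_occP.
split=> [j k jk|j k j0 kj|j k]; rewrite !ffunE ?g3 ?f3 //.
- exact/g1/f1.
- apply: g2; last exact: f2.
  have h : 0 < plen s by apply: leq_ltn_trans (ltn_ord j).
  exact: leq_ltn_trans (f1 (Ordinal h) j j0).
Qed.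

Lemma mono_ord_ge m n (f : 'I_m -> 'I_n) :
  (forall j k : 'I_m, j < k -> f j < f k) -> forall j : 'I_m, j <= f j.
Proof.
move=> h [j lt_j] /=; elim: j lt_j => // j ih lt_j.
exact: leq_ltn_trans (ih (ltnW lt_j)) (h (Ordinal (ltnW lt_j)) _ _).
Qed.

Lemma qc_le_plen s t : qc_le s t -> plen s <= plen t.
Proof.
move=> /qc_leP[f /is_occP[f1 _ _]]; rewrite leqNgt; apply/negP => lt_ts.
have := mono_ord_ge f1 (Ordinal lt_ts).
by rewrite /= leqNgt ltn_ord.
Qed.

Lemma count_ord_lt n k : k <= n -> #|[set i : 'I_n | i < k]| = k.
Proof.
move=> le_kn.
have -> : [set i : 'I_n | i < k] = (widen_ord le_kn) @: setT.
  apply/setP => i; rewrite inE; apply/idP/imsetP => [lt_ik|[j _ ->]].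
    by exists (Ordinal lt_ik) => //; apply: val_inj.
  exact: (ltn_ord j).
rewrite card_imset ?cardsT ?card_ord // => x y /(congr1 val) /= e.
exact: val_inj.
Qed.

Lemma perm_iso_eq n (s t : 'S_n) :
  (forall j k, (t j < t k) = (s j < s k)) -> s = t.
Proof.
move=> h; apply/permP => k; apply: val_inj.
have rank (u : 'S_n) : #|[set j | u j < u k]| = u k.
  rewrite -(card_imset _ (@perm_inj _ u)) -[RHS](@count_ord_lt n); last first.
    exact: ltnW.
  congr #|pred_of_set _|; apply/setP => i; rewrite inE.
  apply/imsetP/idP => [[j]|lt_i]; first by rewrite inE => hj ->.
  by exists ((u^-1)%g i); rewrite ?inE permKV.
rewrite /= -[LHS]rank -[RHS]rank.
by congr #|pred_of_set _|; apply/setP => j; rewrite !inE h.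
Qed.

Lemma qc_le_plen_eq s t : qc_le s t -> plen s = plen t -> s = t.
Proof.
case: s t => [m s] [n t] /= /qc_leP[]; rewrite /plen /= => f fP e.
case: _ / e t f fP => t f /is_occP /= [f1 _ f3].
rewrite /pperm /plen /= in f1 f3 *.
have fid i : f i = i.
  apply: val_inj => /=; apply/eqP; rewrite eqn_leq mono_ord_ge // andbT.
  have h (j k : 'I_m) : j < k -> rev_ord (f (rev_ord j)) < rev_ord (f (rev_ord k)).
    move=> jk; have lt_f : f (rev_ord k) < f (rev_ord j).
      by apply: f1; apply: ltn_sub2l => //; exact: leq_ltn_trans jk (ltn_ord k).
    by apply: ltn_sub2l => //; exact: leq_ltn_trans lt_f (ltn_ord _).
  have := mono_ord_ge h (rev_ord i); rewrite rev_ordK /=.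
  have ltf := ltn_ord (f i); have lti := ltn_ord i.
  by rewrite leq_sub2lE // ltnS.
congr existT; apply: perm_iso_eq => j k.
by rewrite -f3 !fid.
Qed.

Lemma qc_le_anti : antisymmetric qc_le.
Proof.
move=> s t /andP[st ts]; apply: (qc_le_plen_eq st).
by apply/eqP; rewrite eqn_leq !qc_le_plen.
Qed.

Fact qc_display : Order.disp_t. Proof. exact: Order.Disp tt tt. Qed.

HB.instance Definition _ :=
  Order.Le_isPOrder.Build qc_display qperm qc_le_refl qc_le_anti qc_le_trans.

Lemma qperm_leE (s t : qperm) : (s <= t)%O = qc_le s t.
Proof. by []. Qed.

Lemma qperm_le_plen (s t : qperm) : (s <= t)%O -> plen s <= plen t.
Proof. exact: qc_le_plen. Qed.

Lemma qperm_lt_plen (s t : qperm) : (s < t)%O -> plen s < plen t.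
Proof.
rewrite lt_def => /andP[ne le_st]; rewrite ltn_neqAle qperm_le_plen // andbT.
by apply: contra ne => /eqP e; rewrite (qc_le_plen_eq le_st e).
Qed.

Definition covers (d : Order.disp_t) (T : porderType d) (y x : T) : Prop :=
  (x < y)%O /\ ~ (exists z : T, (x < z < y)%O).

(* For s <= t, so that the truncated subtraction is the true difference.      *)
Definition rank_itv (s t : qperm) : nat := plen t - plen s.

Definition qperms_upto (n : nat) : seq qperm :=
  [seq mkqperm p | k <- iota 0 n.+1, p <- enum {: 'S_k}].

(* The elements of the half-open interval [s, t) of the poset. *)
Definition itv_co (s t : qperm) : seq qperm :=
  [seq z <- qperms_upto (plen t) | (s <= z < t)%O].

Lemma mem_itv_co (s t z : qperm) : (z \in itv_co s t) = (s <= z < t)%O.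
Proof.
rewrite mem_filter andb_idr // => /andP[_ /qperm_lt_plen lt_zt].
case: z lt_zt => k p; rewrite /plen /= => lt_k.
by apply/allpairsPdep; exists k, p; rewrite mem_iota mem_enum /= ltnS ltnW.
Qed.

Lemma itv_co_uniq (s t : qperm) : uniq (itv_co s t).
Proof.
apply/filter_uniq/allpairs_uniq_dep; first exact: iota_uniq.
  by move=> k _; exact: enum_uniq.
by move=> [k p] [l q] _ _ /= /eqP; rewrite /mkqperm /Tagged => /eqP.
Qed.

(* The argument k only serves termination; plen t steps are enough by         *)
(* moebius_lt below.                                                          *)
Fixpoint moebius_rec (k : nat) (s t : qperm) : int :=
  if s == t then 1%R else
  if k is k'.+1 then (- \sum_(z <- itv_co s t) moebius_rec k' s z)%R else 0%R.

(* For s not below t, this has the value 0. *)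
Definition moebius (s t : qperm) : int := moebius_rec (plen t) s t.

Lemma moebius_refl (s : qperm) : moebius s s = 1%R.
Proof. by rewrite /moebius; case: (plen s) => /= [|k]; rewrite eqxx. Qed.

Lemma moebius_rec_enough k (s t : qperm) :
  plen t <= k -> moebius_rec k s t = moebius s t.
Proof.
rewrite /moebius; elim/ltn_ind: k s t => -[|k] ih s t le_tk.
  by move: le_tk; rewrite leqn0 => /eqP ->.
case e: (plen t) => [|n] /=; case: eqP => // _.
  rewrite big_seq big1 ?oppr0 // => z; rewrite mem_itv_co => /andP[_].
  by move/qperm_lt_plen; rewrite e.
congr (- _)%R; rewrite !big_seq; apply: eq_bigr => z.
rewrite mem_itv_co => /andP[_ /qperm_lt_plen]; rewrite e ltnS => le_zn.
have le_nk : n <= k by rewrite -ltnS -e.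
by rewrite (ih k) ?(leq_trans le_zn) // (ih n) // ltnS.
Qed.

Lemma moebius_lt (s t : qperm) : (s < t)%O ->
  moebius s t = (- \sum_(z <- itv_co s t) moebius s z)%R.
Proof.
move=> lt_st; rewrite {1}/moebius.
case e: (plen t) => [|n]; first by have := qperm_lt_plen lt_st; rewrite e.
rewrite /= (lt_eqF lt_st); congr (- _)%R; rewrite !big_seq.
apply: eq_bigr => z; rewrite mem_itv_co => /andP[_ /qperm_lt_plen].
by rewrite e ltnS; exact: moebius_rec_enough.
Qed.

(* At least three is the same as exactly three here: the elements covered by  *)
(* t arise by deleting its first, its second or its last letter.              *)
Definition covers_three (s t : qperm) : Prop :=
  exists x y z : qperm,
    [/\ uniq [:: x; y; z] &
        forall r, r \in [:: x; y; z] -> (s <= r <= t)%O /\ covers t r].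

(* Main.v *)
Require Import Defs.
From mathcomp Require Import all_boot all_order all_algebra all_fingroup.
From mathcomp Require Import zify.

(* Positions are numbered from 0. Let the unique occurrence of sigma in tau   *)
(* use the position p and the block [q, e), and let n be the length of tau.   *)
(* An element of [sigma, tau] is the pattern of a set {i} u [x, y) of         *)
(* positions containing {p} u [q, e). As sigma occurs only once, the order on *)
(* the interval can be read off from the sets: the pattern of {i} u [x, y)    *)
(* lies below that of {i'} u [x', y') iff [x, y) is contained in [x', y') and *)
(* some j in {i'} u [x', x) has its letter on the same side as that of i of   *)
(* every letter in the block [x, y).                                          *)
(*   If c is strictly between sigma and tau, then moebius sigma tau is minus  *)
(* the sum of the moebius sigma z over the z < tau with z not below c. Taking *)
(* for c the pattern of tau without its last letter if e <= n - 2, without    *)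
(* its second letter if p = 0 and q >= 3, and of [p, n) if 0 < p < q - 1,     *)
(* every such z satisfies the same inequality for its own occurrence of       *)
(* sigma, so all terms vanish by induction. In the remaining vanishing cases  *)
(* q = p + 1 and adjoining the position p - 1 to the block is a closure       *)
(* operator on [sigma, tau) that moves sigma. The nonzero values come from    *)
(* intervals of rank 2 with two coatoms, and from one family of rank 3.       *)

Set Implicit Arguments.
Unset Strict Implicit.
Unset Printing Implicit Defensive.

Import Order.Theory GRing.Theory.

(** * Occurrences as pairs of positions *)

(** [occ_at_mono] and [once_at_mono] are the two directions of the order criterion described above.
    [once_at_below] passes uniqueness on to every z of the interval, which allows induction on
    [sigma, z]. [moebius_split0] yields the three lemmas on gaps, [moebius_closure] yields
    [moebius_deep]. Once the gaps are excluded, e >= n - 1, and q = p + 1 or (p, q) = (0, 2). In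
    rank at least 2, p = 0 forces q = 2 and e = n - 1, and p = 1 forces e = n - 1; both are case
    (3). For p = 2, e = n gives case (4) and e = n - 1 gives case (5), provided that a later letter
    separates the first two letters of tau. This fails exactly when these are consecutive integers
    ([same_side01E]); then, and for p >= 3, [moebius_deep] applies. *)

Definition entry (t : qperm) (k : nat) : nat := nth 0 (oneline t) k.

Lemma entry_ord (t : qperm) (i : 'I_(plen t)) : entry t i = (pperm t i).+1.
Proof.
by rewrite /entry (nth_map i) ?size_enum_ord // nth_ord_enum.
Qed.

Lemma entry_bound t k : k < plen t -> 0 < entry t k <= plen t.
Proof. by move=> hk; rewrite (entry_ord (Ordinal hk)) ltn_ord. Qed.

Lemma entry_inj t j k : j < plen t -> k < plen t ->
  entry t j = entry t k -> j = k.
Proof.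
move=> hj hk; rewrite (entry_ord (Ordinal hj)) (entry_ord (Ordinal hk)) => -[].
by move/val_inj/perm_inj/(congr1 val).
Qed.

Lemma entry_surj t v : 0 < v <= plen t -> exists2 k, k < plen t & entry t k = v.
Proof.
case: v => // v /= hv; exists ((pperm t)^-1%g (Ordinal hv)) => //.
by rewrite entry_ord permKV.
Qed.

(* The position of the k-th letter of an occurrence whose first letter is at  *)
(* position i and whose remaining letters form a block starting at x.         *)
Definition qpos (i x k : nat) : nat := if k is k'.+1 then x + k' else i.

(** From length 2 on, the pair (i, x) determines the occurrence; its block is [x, x + plen s -
    1). *)
Definition occ_at (s t : qperm) (i x : nat) : Prop :=
  [/\ 1 < plen s, i < x, x + plen s <= (plen t).+1 &
      forall j k, j < plen s -> k < plen s ->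
        (entry t (qpos i x j) < entry t (qpos i x k)) =
        (entry s j < entry s k)].

Lemma qpos_gt0 i x k : 0 < k -> qpos i x k = x + k.-1.
Proof. by case: k. Qed.

Lemma qpos_lt i x j k : i < x -> j < k -> qpos i x j < qpos i x k.
Proof. by case: j k => [|j] [|k] //=; lia. Qed.

Lemma qpos_inj i x j k : i < x -> qpos i x j = qpos i x k -> j = k.
Proof. by case: j k => [|j] [|k] //=; lia. Qed.

Lemma qpos_comp j y i x k : i < x ->
  qpos j y (qpos i x k) = qpos (qpos j y i) (qpos j y x) k.
Proof. by case: k => [|k] //=; case: x => //= x _; lia. Qed.

Lemma qpos_bound i x k l n : i < x -> x + l <= n.+1 -> 1 < l -> k < l ->
  qpos i x k < n.
Proof. by case: k => [|k] /=; lia. Qed.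

Lemma occ_at_comp r s t i x j y :
  occ_at r s i x -> occ_at s t j y -> occ_at r t (qpos j y i) (qpos j y x).
Proof.
move=> [r1 ix xr h] [s1 jy ys h']; split=> //; first exact: qpos_lt.
- by case: x ix xr {h} => //= x; lia.
- move=> a b ha hb; rewrite -!qpos_comp // h' ?h //.
    exact: qpos_bound ha.
  exact: qpos_bound hb.
Qed.

Lemma is_occ_qpos m n (s : 'S_m) (t : 'S_n) f (m1 : 1 < m) : is_occ s t f ->
  forall k : 'I_m, f k = qpos (f (Ordinal (ltnW m1))) (f (Ordinal m1)) k :> nat.
Proof.
case/is_occP=> f1 f2 _ [k hk] /=; elim: k hk => [|k IH] hk /=.
  by congr (val (f _)); apply: val_inj.
case: k IH hk => [|k] IH hk /=.
  by rewrite addn0; congr (val (f _)); apply: val_inj.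
rewrite (f2 (Ordinal (ltnW hk))) // IH /=; lia.
Qed.

Lemma occ_at_is_occ s t (m1 : 1 < plen s) f : is_occ (pperm s) (pperm t) f ->
  occ_at s t (f (Ordinal (ltnW m1))) (f (Ordinal m1)).
Proof.
move=> fo; have fq := is_occ_qpos m1 fo; case/is_occP: (fo) => f1 _ f3.
split=> //; first by apply: f1.
- have hl : (plen s).-1 < plen s by lia.
  have := ltn_ord (f (Ordinal hl)); rewrite fq /= qpos_gt0; last by lia.
  by set q := nat_of_ord _; lia.
- move=> j k hj hk; rewrite -(fq (Ordinal hj)) -(fq (Ordinal hk)) !entry_ord.
  by rewrite ltnS f3 (entry_ord (Ordinal hj)) (entry_ord (Ordinal hk)) ltnS.
Qed.

Lemma is_occ_occ_at s t i x : occ_at s t i x ->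
  exists2 f : {ffun 'I_(plen s) -> 'I_(plen t)}, is_occ (pperm s) (pperm t) f &
    forall k, f k = qpos i x k :> nat.
Proof.
move=> [s1 ix xs h].
have hb (k : 'I_(plen s)) : qpos i x k < plen t.
  by apply: (qpos_bound ix xs s1).
exists [ffun k => Ordinal (hb k)]; last by move=> k; rewrite ffunE.
apply/is_occP; split=> [j k jk|j k|j k]; rewrite !ffunE /=.
- exact: qpos_lt.
- by case: (nat_of_ord j) => // j' _ ->; rewrite /=; lia.
- have := h j k (ltn_ord j) (ltn_ord k).
  rewrite (entry_ord j) (entry_ord k) ltnS => <-.
  by rewrite (entry_ord (Ordinal (hb j))) (entry_ord (Ordinal (hb k))) ltnS.
Qed.

Lemma le_occ_at s t : 1 < plen s -> (s <= t)%O -> exists i x, occ_at s t i x.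
Proof.
by move=> s1 /qc_leP[f /(occ_at_is_occ s1) h]; do 2!eexists; exact: h.
Qed.

Lemma occ_at_le s t i x : occ_at s t i x -> (s <= t)%O.
Proof. by case/is_occ_occ_at=> f fo _; apply/qc_leP; exists f. Qed.

Lemma le_plen_eq (s t : qperm) : (s <= t)%O -> plen t <= plen s -> s = t.
Proof.
move=> st h; apply: (qc_le_plen_eq st); apply/eqP.
by rewrite eqn_leq h qperm_le_plen.
Qed.

Lemma lt_of_plen (s t : qperm) : (s <= t)%O -> plen s < plen t -> (s < t)%O.
Proof.
by move=> st h; rewrite lt_def st andbT; apply: contraTneq h => ->; rewrite ltnn.
Qed.

(** Standardization: each chosen letter is replaced by its rank among the chosen letters. *)
Lemma occ_at_ex t i x l : 1 < l -> i < x -> x + l <= (plen t).+1 ->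
  exists r, plen r = l /\ occ_at r t i x.
Proof.
move=> l1 ix xl.
have hb (k : 'I_l) : qpos i x k < plen t by apply: (qpos_bound ix xl l1).
pose v (k : 'I_l) := entry t (qpos i x k).
have vinj : injective v.
  by move=> j k /(entry_inj (hb j) (hb k)) /(qpos_inj ix) /val_inj.
pose rk (k : 'I_l) := #|[set j | v j < v k]|.
have rk_lt (k : 'I_l) : rk k < l.
  rewrite -[X in _ < X]card_ord -cardsT; apply: proper_card.
  by rewrite properE subsetT; apply/subsetPn; exists k; rewrite !inE ?ltnn.
have rkE j k : (rk j < rk k) = (v j < v k).
  apply/idP/idP => [|h].
    apply: contraLR; rewrite -!leqNgt => h; apply: subset_leq_card.
    by apply/subsetP=> a; rewrite !inE => /leq_trans; apply.
  apply: proper_card; rewrite properE; apply/andP; split.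
    by apply/subsetP=> a; rewrite !inE => /ltn_trans; apply.
  by apply/subsetPn; exists j; rewrite !inE ?ltnn.
have rinj : injective (fun k => Ordinal (rk_lt k)).
  move=> j k /(congr1 val) /= e; apply: vinj.
  have := rkE j k; have := rkE k j; rewrite e ltnn; lia.
exists (mkqperm (perm rinj)); split=> //; split=> // j k hj hk.
have e a (ha : a < l) : entry (mkqperm (perm rinj)) a = (rk (Ordinal ha)).+1.
  by rewrite (@entry_ord (mkqperm (perm rinj)) (Ordinal ha)) permE.
by rewrite (e _ hj) (e _ hk) ltnS rkE.
Qed.

(** * The order on the interval in terms of positions *)

Definition same_side (t : qperm) (x e i j : nat) : Prop :=
  forall k, x <= k < e -> (entry t i < entry t k) = (entry t j < entry t k).

(** Beyond the block itself, the pattern only records how the first letter compares with the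
    block. *)
Lemma occ_at_same_side r t i j x : occ_at r t i x -> j < x ->
  same_side t x (x + plen r - 1) i j -> occ_at r t j x.
Proof.
move=> [r1 ix xr h] jx ij; split=> // a b ha hb; rewrite -h //.
have flip k : x <= k < x + plen r - 1 ->
    (entry t k < entry t i) = (entry t k < entry t j).
  move=> hk; have := ij _ hk.
  have ni : entry t k <> entry t i by move/entry_inj; lia.
  have nj : entry t k <> entry t j by move/entry_inj; lia.
  by lia.
case: a b ha hb => [|a] [|b] ha hb /=; rewrite ?ltnn //.
  by rewrite ij //; lia.
by rewrite flip //; lia.
Qed.

Lemma occ_at_mono r r' t i x i' x' : occ_at r t i x -> occ_at r' t i' x' ->
  x' <= x -> x + plen r <= x' + plen r' -> i = i' \/ x' <= i -> (r <= r')%O.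
Proof.
move=> [r1 ix xr h] [r1' ix' xr' h'] xx ee ii.
(* [u] is the index inside r' of position i, and [(x - x').+1] that of x. *)
pose u := if i == i' then 0 else i - x' + 1.
have uE : qpos i' x' u = i.
  by rewrite /u; case: eqP => [->//|] ?; rewrite addn1 /=; lia.
have wE : qpos i' x' (x - x').+1 = x by rewrite /=; lia.
have uw : u < (x - x').+1 by rewrite /u; case: eqP; lia.
suff : occ_at r r' u (x - x').+1 by exact: occ_at_le.
split=> //; first by lia.
move=> a b ha hb; rewrite -h' ?qpos_comp ?uE ?wE ?h //.
  by apply: (qpos_bound uw _ r1 ha); lia.
by apply: (qpos_bound uw _ r1 hb); lia.
Qed.

Definition once_at (s t : qperm) (p q : nat) : Prop :=
  occ_at s t p q /\ forall i x, occ_at s t i x -> i = p /\ x = q.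

Lemma once_at_le s t p q : once_at s t p q -> (s <= t)%O.
Proof. by case=> /occ_at_le. Qed.

Lemma once_at_plen s t p q : once_at s t p q -> 1 < plen s.
Proof. by case=> -[]. Qed.

(** Any occurrence of s in r, composed with that of r in t, must give (p, q), and [qpos] is
    injective. *)
Lemma once_at_below s t p q r i x : once_at s t p q -> (s <= r)%O ->
  occ_at r t i x ->
  exists u v, [/\ once_at s r u v, qpos i x u = p & qpos i x v = q].
Proof.
move=> [o un] sr ro; have s1 : 1 < plen s by case: o.
have [u [v uv]] := le_occ_at s1 sr; exists u, v.
have [-> ->] := un _ _ (occ_at_comp uv ro); split=> //; split=> // a b ab.
have [ix] : i < x by case: ro.
have [e1 e2] := un _ _ (occ_at_comp ab ro).
have [e3 e4] := un _ _ (occ_at_comp uv ro).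
by split; apply: (@qpos_inj i x) => //; rewrite ?e1 ?e2.
Qed.

(* Both occurrences of r contain the unique occurrence of s, which pins down  *)
(* the block of r; only the first letter of r may move.                       *)
Lemma once_at_mono s t p q r r' i x i' x' : once_at s t p q -> (s <= r)%O ->
  occ_at r t i x -> occ_at r' t i' x' -> (r <= r')%O ->
  [/\ x' <= x, x + plen r <= x' + plen r' &
      exists j, [/\ j < x, j = i' \/ x' <= j &
        same_side t x (x + plen r - 1) i j]].
Proof.
move=> o sr ro ro' rr.
have [u [v [[[s1 uv vs _] _] eu ev]]] := once_at_below o sr ro.
have r1 : 1 < plen r by case: ro.
have [u' [v' uv']] := le_occ_at r1 rr.
have ro2 := occ_at_comp uv' ro'.
have [u1 [v1 [o1 eu1 ev1]]] := once_at_below o sr ro2.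
have [u2 [v2 [o2 eu2 ev2]]] := once_at_below o sr ro.
have [? ?] : u1 = u2 /\ v1 = v2 by case: o2 => _ un2; apply: un2; case: o1.
subst u1 v1.
have v20 : 0 < v2 by case: o2 => -[]; lia.
have [_ hu' hv' _] := uv'.
(* Both embeddings of r send its letter of index [v2 > 0] to position q, so both start the block of
   r at x. *)
have ex : qpos i' x' v' = x.
  by case: v2 v20 ev1 ev2 {o1 o2} => //= k _ <-; lia.
rewrite ex in ro2 *.
have [_ ix' _ _] := ro'; have [_ jx _ h2] := ro2; have [_ ix _ h1] := ro.
split.
- by case: v' hu' hv' ex {uv' ev1 eu1} => //=; lia.
- by case: v' hu' hv' ex {uv' ev1 eu1} => //=; lia.
- exists (qpos i' x' u'); split=> //.
    by case: u' {uv' hu' ro2 ev1 eu1 jx h2} => [|u'] /=; [left|right; lia].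
  move=> k hk; have hk1 : (k - x).+1 < plen r by lia.
  have := h1 0 (k - x).+1 (ltnW r1) hk1; rewrite -(h2 0) //; last by lia.
  by rewrite /= subnKC //; lia.
Qed.

(** * Sums of Moebius values *)

Lemma moebius_sum_le (s c t : qperm) : (s < c)%O -> (c < t)%O ->
  (\sum_(z <- itv_co s t | (z <= c)%O) moebius s z = 0)%R.
Proof.
move=> sc ct; rewrite -big_filter.
have pe : perm_eq [seq z <- itv_co s t | (z <= c)%O] (c :: itv_co s c).
  apply: uniq_perm => [||z]; first exact/filter_uniq/itv_co_uniq.
    by rewrite /= mem_itv_co ltxx andbF itv_co_uniq.
  rewrite mem_filter inE !mem_itv_co le_eqVlt.
  case: eqP => [->|_] /=; first by rewrite ltW // ct.
  apply/andP/andP=> [[zc /andP[]]|[sz zc]] //.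
  by rewrite zc sz (lt_trans zc ct).
by rewrite (perm_big _ pe) big_cons moebius_lt //= addNr.
Qed.

(** The terms with z <= c add up to 0 by the defining relation on [s, c], so a good choice of c
    discards most of the sum. *)
Lemma moebius_split (s c t : qperm) : (s < c)%O -> (c < t)%O ->
  (moebius s t = - \sum_(z <- itv_co s t | ~~ (z <= c)%O) moebius s z)%R.
Proof.
move=> sc ct; rewrite moebius_lt ?(lt_trans sc ct) //.
by rewrite (bigID (fun z => (z <= c)%O)) /= moebius_sum_le // add0r.
Qed.

Lemma moebius_split_seq (s c t : qperm) (l : seq qperm) :
  (s < c)%O -> (c < t)%O -> uniq l ->
  (forall z, (z \in l) = [&& (s <= z)%O, (z < t)%O & ~~ (z <= c)%O]) ->
  (moebius s t = - \sum_(z <- l) moebius s z)%R.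
Proof.
move=> sc ct ul lE; rewrite (moebius_split sc ct) -big_filter.
congr (- _)%R; apply: perm_big; apply: uniq_perm => // [|z].
  exact/filter_uniq/itv_co_uniq.
by rewrite mem_filter mem_itv_co lE [RHS]andbA andbC.
Qed.

Lemma moebius_split0 (s c t : qperm) : (s < c)%O -> (c < t)%O ->
  (forall z, (s <= z)%O -> (z < t)%O -> ~~ (z <= c)%O -> moebius s z = 0%R) ->
  moebius s t = 0%R.
Proof.
move=> sc ct h; rewrite (moebius_split sc ct) big_seq_cond big1 ?oppr0 // => z.
by rewrite mem_itv_co -andbA => /and3P[]; exact: h.
Qed.

Lemma covers_moebius (s t : qperm) : covers t s -> moebius s t = (-1)%R.
Proof.
move=> [st no]; rewrite moebius_lt //.
have pe : perm_eq (itv_co s t) [:: s].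
  apply: uniq_perm => // [|z]; first exact: itv_co_uniq.
  rewrite mem_itv_co inE le_eqVlt eq_sym.
  case: eqP => [->|_] //=; apply/negP => /andP[h1 h2]; apply: no.
  by exists z; rewrite h1 h2.
by rewrite (perm_big _ pe) big_seq1 moebius_refl.
Qed.

Lemma covers_plen (s t : qperm) :
  (s <= t)%O -> plen t = (plen s).+1 -> covers t s.
Proof.
move=> st e; split; first by apply: lt_of_plen => //; rewrite e.
by case=> z /andP[/qperm_lt_plen h1 /qperm_lt_plen]; lia.
Qed.

(** Makes the closures of the finitely many z in [s, t) into a function without a choice axiom. *)
Lemma seq_choice (T : eqType) (l : seq T) (P : T -> T -> Prop) :
  (forall x, x \in l -> exists y, P x y) ->
  exists g, forall x, x \in l -> P x (g x).
Proof.
elim: l => [|a l IH] h; first by exists id.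
have [g hg] : exists g, forall x, x \in l -> P x (g x).
  by apply: IH => x xl; apply: h; rewrite inE xl orbT.
have [y ay] := h a (mem_head _ _).
exists (fun x => if x == a then y else g x) => x; rewrite inE.
by case: eqP => [->|_] //=; exact: hg.
Qed.

Lemma partition_big_seq (V : nmodType) (T : eqType) (l : seq T) (Q : pred T)
    (g : T -> T) (F : T -> V) :
  (\sum_(z <- l | Q (g z)) F z =
   \sum_(c <- undup (map g l) | Q c) \sum_(z <- l | g z == c) F z)%R.
Proof.
rewrite (exchange_big_dep (fun z => Q (g z))) /=; last by move=> c z Qc /eqP ->.
rewrite big_seq_cond [RHS]big_seq_cond; apply: eq_bigr => z /andP[zl Qz].
rewrite -big_filter.
have pe : perm_eq [seq c <- undup (map g l) | Q c && (g z == c)] [:: g z].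
  apply: uniq_perm => // [|c]; first exact/filter_uniq/undup_uniq.
  rewrite mem_filter mem_undup inE [RHS]eq_sym.
  case: eqP => [<-|_]; last by rewrite andbF.
  by rewrite Qz map_f.
by rewrite (perm_big _ pe) big_seq1.
Qed.

(* If z |-> g z, the least element of K above z, is a closure operator on     *)
(* [s, t) that moves s, then the values of moebius s over each fibre of g     *)
(* already add up to 0.                                                       *)
Lemma moebius_closure (s t : qperm) (K : qperm -> Prop) : (s < t)%O -> ~ K s ->
  (forall z, (s <= z)%O -> (z < t)%O ->
     exists c, [/\ K c, (z <= c)%O, (c < t)%O &
       forall c', K c' -> (c' < t)%O -> (z <= c')%O -> (c <= c')%O]) ->
  moebius s t = 0%R.
Proof.
move=> st nKs ex; set l := itv_co s t.
pose least z c := [/\ K c, (z <= c)%O, (c < t)%O &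
  forall c', K c' -> (c' < t)%O -> (z <= c')%O -> (c <= c')%O].
have [g gP] : exists g, forall z, z \in l -> least z (g z).
  by apply: seq_choice => z; rewrite mem_itv_co => /andP[]; exact: ex.
(* Induction on the length of c: the sum over [s, c] is 0 and splits into the fibres over the closed
   c' <= c, and the fibres over c' < c contribute 0. *)
have fib0 c : c \in undup (map g l) ->
    (\sum_(z <- l | g z == c) moebius s z = 0)%R.
  have [k le_k] := ubnP (plen c); elim: k c le_k => // k IH c le_k cl.
  have := cl; rewrite mem_undup => /mapP[w wl cE].
  have [Kc wc ct _] := gP w wl; rewrite -cE in Kc wc ct.
  have sw : (s <= w)%O by move: wl; rewrite mem_itv_co => /andP[].
  have sc : (s < c)%O.
    by rewrite lt_def (le_trans sw wc) andbT; apply/eqP => e; rewrite e in Kc.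
  have := moebius_sum_le sc ct; rewrite -/l.
  have -> : (\sum_(z <- l | (z <= c)%O) moebius s z =
             \sum_(z <- l | (g z <= c)%O) moebius s z)%R.
    rewrite big_seq_cond [RHS]big_seq_cond; apply: eq_bigl => z.
    case zl: (z \in l) => //=; have [_ h1 _ h2] := gP z zl.
    by apply/idP/idP => [|/(le_trans h1)//]; exact: h2.
  rewrite (partition_big_seq l (fun c' => (c' <= c)%O)).
  rewrite -big_filter (bigD1_seq c) /= ?filter_uniq ?undup_uniq //; last first.
    by rewrite mem_filter lexx.
  rewrite big_filter_cond [X in (_ + X)%R]big_seq_cond.
  rewrite [X in (_ + X)%R]big1 ?addr0 //.
  move=> c' /and3P[c'l c'c ne].
  apply: IH => //; have : (c' < c)%O by rewrite lt_def eq_sym ne.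
  by move/qperm_lt_plen; lia.
rewrite moebius_lt // -/l (partition_big_seq l xpredT g).
by rewrite big_seq_cond big1 ?oppr0 // => c; rewrite andbT; exact: fib0.
Qed.

(** * Vanishing *)

(** Coordinates of s inside z: either p is the first letter of z, or it lies in the block of z. *)
Lemma once_at_locate s t p q z : once_at s t p q -> (s <= z)%O -> (z <= t)%O ->
  exists i x u v, [/\ occ_at z t i x, once_at s z u v, x + v = q.+1 &
    u = 0 /\ i = p \/ 0 < u /\ x + u = p.+1].
Proof.
move=> o sz zt.
have z1 : 1 < plen z by rewrite (leq_trans (once_at_plen o)) ?qperm_le_plen.
have [i [x zo]] := le_occ_at z1 zt.
have [u [v [ouv eu ev]]] := once_at_below o sz zo.
exists i, x, u, v; split=> //.
  by case: ouv => -[_ uv _ _] _; rewrite -ev; case: v uv {ev} => //= *; lia.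
by rewrite -eu; case: u {ouv eu} => [|u] /=; [left|right; lia].
Qed.

(** If z is not below t without its last letter, its block reaches the end of t, so at least two
    letters of z still follow its copy of s. *)
Lemma moebius_right_gap s t p q : once_at s t p q -> q + plen s < plen t ->
  moebius s t = 0%R.
Proof.
have [k] := ubnP (plen t); elim: k t p q => // k IH t p q le_k o gap.
have [so _] := o; have [s1 pq xs _] := so.
have [c [cl co]] : exists c, plen c = (plen t).-1 /\ occ_at c t 0 1.
  by apply: occ_at_ex; lia.
apply: (@moebius_split0 s c).
- by apply: lt_of_plen; [apply: (occ_at_mono so co)|]; lia.
- by apply: lt_of_plen; [exact: occ_at_le co|lia].
- move=> z sz zt zc.
  have [i [x [u [v [zo ouv e1 e2]]]]] := once_at_locate o sz (ltW zt).
  have [z1 ix xz _] := zo; have ltz := qperm_lt_plen zt.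
  apply: (IH z u v) => //; first by lia.
  suff : plen t < x + plen z by lia.
  by rewrite ltnNge; apply: contra zc => h; apply: (occ_at_mono zo co); lia.
Qed.

(** Position 0 must be the first letter of z. If z is not below c, its block starts at position 1,
    and the gap in s stays as wide. *)
Lemma moebius_first_gap s t q : once_at s t 0 q -> 2 < q -> moebius s t = 0%R.
Proof.
have [k] := ubnP (plen t); elim: k t q => // k IH t q le_k o gap.
have [so _] := o; have [s1 pq xs _] := so.
have [c [cl co]] : exists c, plen c = (plen t).-1 /\ occ_at c t 0 2.
  by apply: occ_at_ex; lia.
apply: (@moebius_split0 s c).
- by apply: lt_of_plen; [apply: (occ_at_mono so co)|]; lia.
- by apply: lt_of_plen; [exact: occ_at_le co|lia].
- move=> z sz zt zc.
  have [i [x [u [v [zo ouv e1 e2]]]]] := once_at_locate o sz (ltW zt).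
  have [z1 ix xz _] := zo; have ltz := qperm_lt_plen zt.
  have [u0 i0] : u = 0 /\ i = 0 by lia.
  subst u i; apply: (IH z v) => //; first by lia.
  suff : x < 2 by lia.
  by rewrite ltnNge; apply: contra zc => h; apply: (occ_at_mono zo co); lia.
Qed.

(** If p is the first letter of z, then z is below the pattern of [p, n). Otherwise p is in the
    block of z and the same gap appears there. *)
Lemma moebius_inner_gap s t p q : once_at s t p q -> 0 < p -> p.+1 < q ->
  moebius s t = 0%R.
Proof.
have [k] := ubnP (plen t); elim: k t p q => // k IH t p q le_k o p0 gap.
have [so _] := o; have [s1 pq xs _] := so.
have [c [cl co]] : exists c, plen c = plen t - p /\ occ_at c t p p.+1.
  by apply: occ_at_ex; lia.
apply: (@moebius_split0 s c).
- by apply: lt_of_plen; [apply: (occ_at_mono so co)|]; lia.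
- by apply: lt_of_plen; [exact: occ_at_le co|lia].
- move=> z sz zt zc.
  have [i [x [u [v [zo ouv e1 e2]]]]] := once_at_locate o sz (ltW zt).
  have [z1 ix xz _] := zo; have ltz := qperm_lt_plen zt.
  suff u0 : 0 < u by apply: (IH z u v) => //; lia.
  rewrite lt0n; apply: contra zc => /eqP u0.
  by apply: (occ_at_mono zo co); lia.
Qed.

Lemma ltn_same_side a b c d : (a < c) = (b < c) -> (a < c) != (d < c) ->
  (a < d) = (b < d).
Proof. by case: (ltnP a c); case: (ltnP b c); case: (ltnP d c) => //; lia. Qed.

(** The closure adjoins p - 1 and must stay strictly below t. If z starts at p, position 0 stays
    free. If a first letter i < p - 1 is kept, p >= 3 leaves 0 or 1 free; for p = 2 this would need
    a block that separates the first two letters. *)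
Lemma moebius_deep s t p : once_at s t p p.+1 ->
  2 < p \/ p = 2 /\ same_side t 2 (plen t) 0 1 -> moebius s t = 0%R.
Proof.
move=> o hp; have [so _] := o; have [s1 _ xs _] := so.
(* For z above s this says that some occurrence of z has p - 1 in its block, or as a first letter
   adjacent to the block. *)
pose K z := exists i x, occ_at z t i x /\ (x < p \/ i = p.-1 /\ x = p).
apply: (@moebius_closure s t K).
- by apply: lt_of_plen; [exact: occ_at_le so|lia].
- by case=> i [x [io h]]; have [_ un] := o; have [? ?] := un _ _ io; lia.
move=> z sz zt; have ltz := qperm_lt_plen zt.
have [i [x [u [v [zo ouv e1 e2]]]]] := once_at_locate o sz (ltW zt).
have [z1 ix xz _] := zo.
have v0 : u < v by case: ouv => -[].
pose same := same_side t x (x + plen z - 1) i p.-1.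
have [xp|px] := ltnP x p.
  by exists z; split=> //; exists i, x; auto.
have [? | xp] : x = p.+1 \/ x = p by lia.
  subst x; have ? : i = p by lia.
  subst i.
  have [c [cl co]] : exists c, plen c = (plen z).+1 /\ occ_at c t p.-1 p.
    by apply: occ_at_ex; lia.
  exists c; split.
  - by exists p.-1, p; auto.
  - by apply: (occ_at_mono zo co); lia.
  - by apply: lt_of_plen; [exact: occ_at_le co|lia].
  - move=> c' [i' [x' [c'o h]]] c't zc'.
    have [xx ee _] := once_at_mono o sz zo c'o zc'.
    by apply: (occ_at_mono co c'o); lia.
subst x.
(* If no letter of the block separates i from p - 1, then p - 1 can replace i, and z is already
   closed. *)
have [[k /andP[hk nk]]|sm] : (exists k, (p <= k < p + plen z - 1) &&
   ((entry t i < entry t k) != (entry t p.-1 < entry t k))) \/ same.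
- pose P k := (p <= k < p + plen z - 1) &&
   ((entry t i < entry t k) != (entry t p.-1 < entry t k)).
  have [|no] := boolP (has P (iota 0 (plen t))).
    by case/hasP=> k _ Pk; left; exists k.
  right=> k hk.
  have [//|/eqP nk] := (entry t i < entry t k) =P (entry t p.-1 < entry t k).
  case/negP: no.
  by apply/hasP; exists k; [rewrite mem_iota; lia|rewrite /P hk nk].
- have ip : i < p.-1.
    suff : i <> p.-1 by lia.
    by move=> e; move: nk; rewrite e eqxx.
  have p3 : 2 < p.
    case: hp => // -[p2 sm]; subst p.
    have i0 : i = 0 by lia.
    by move: nk; rewrite i0 sm ?eqxx //; lia.
  have [c [cl co]] : exists c, plen c = (plen z).+1 /\ occ_at c t i p.-1.
    by apply: occ_at_ex; lia.
  exists c; split.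
  - by exists i, p.-1; split=> //; lia.
  - by apply: (occ_at_mono zo co); lia.
  - by apply: lt_of_plen; [exact: occ_at_le co|lia].
  - move=> c' [i' [x' [c'o h]]] c't zc'.
    have [xx ee [j [jp ji sj]]] := once_at_mono o sz zo c'o zc'.
    have sk := sj k hk.
    have jp1 : j <> p.-1 by move=> e; move: nk; rewrite sk e eqxx.
    (* The letter at k separates that at p - 1 from those at i and j, so i and j are on the same
       side of p - 1 too. *)
    have co' : occ_at c t j p.-1.
      apply: (occ_at_same_side co); first by lia.
      move=> l hl; have [|lp] := leqP p l; first by move=> pl; apply: sj; lia.
      have -> : l = p.-1 by lia.
      exact: ltn_same_side sk nk.
    by apply: (occ_at_mono co' c'o); lia.
- have zo' : occ_at z t p.-1 p by apply: occ_at_same_side zo _ sm; lia.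
  by exists z; split=> //; exists p.-1, p; auto.
Qed.

(** * Nonzero values *)

(** Splitting at c leaves the single term d, which covers s. *)
Lemma moebius_rank2 (s c d t : qperm) : plen t = (plen s).+2 ->
  plen c = (plen s).+1 -> plen d = (plen s).+1 ->
  (s <= c)%O -> (s <= d)%O -> (c <= t)%O -> (d <= t)%O -> ~~ (d <= c)%O ->
  (forall z, (s <= z)%O -> (z < t)%O -> (z <= c)%O \/ (z <= d)%O) ->
  moebius s t = 1%R.
Proof.
move=> nt nc nd sc sd ct dt dc h.
rewrite (@moebius_split_seq s c t [:: d]) //.
- by rewrite big_seq1 covers_moebius ?opprK //; apply: covers_plen.
- by apply: lt_of_plen => //; lia.
- by apply: lt_of_plen => //; lia.
move=> z; rewrite inE; apply/eqP/and3P => [->|[sz zt zc]].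
  by split=> //; apply: lt_of_plen => //; lia.
have [zc'|zd] := h z sz zt; first by rewrite zc' in zc.
apply: le_plen_eq zd _; rewrite nd; apply: qperm_lt_plen.
by rewrite lt_def sz andbT; apply: contra zc => /eqP ->.
Qed.

(** [c], [d0], [d1] arise by deleting the last, the second and the first letter. Any occurrence of a
    smaller z misses one of these positions. *)
Lemma coatoms_ex t : 2 < plen t -> exists c d0 d1,
  [/\ [/\ plen c = (plen t).-1, plen d0 = (plen t).-1 & plen d1 = (plen t).-1],
      [/\ occ_at c t 0 1, occ_at d0 t 0 2 & occ_at d1 t 1 2] &
      forall z, 1 < plen z -> (z < t)%O ->
        [\/ (z <= c)%O, (z <= d0)%O | (z <= d1)%O]].
Proof.
move=> t2.
have [c [cl co]] : exists c, plen c = (plen t).-1 /\ occ_at c t 0 1.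
  by apply: occ_at_ex; lia.
have [d0 [d0l d0o]] : exists c, plen c = (plen t).-1 /\ occ_at c t 0 2.
  by apply: occ_at_ex; lia.
have [d1 [d1l d1o]] : exists c, plen c = (plen t).-1 /\ occ_at c t 1 2.
  by apply: occ_at_ex; lia.
exists c, d0, d1; split=> // z z1 zt; have ltz := qperm_lt_plen zt.
have [i [x zo]] := le_occ_at z1 (ltW zt); have [_ ix xz _] := zo.
have [h|h] := leqP (x + plen z) (plen t).
  by constructor 1; apply: (occ_at_mono zo co); lia.
have [i0|i0] := posnP i.
  by constructor 2; apply: (occ_at_mono zo d0o); lia.
by constructor 3; apply: (occ_at_mono zo d1o); lia.
Qed.

(** s is t without its second and last letters; [d1] lacks position 0 and is not above s. *)
Lemma moebius_first s t : once_at s t 0 2 -> plen t = (plen s).+2 ->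
  moebius s t = 1%R.
Proof.
move=> o nt; have [so _] := o; have [s1 _ _ _] := so.
have t2 : 2 < plen t by lia.
have [c [d0 [d1 [[nc nd0 nd1] [co d0o d1o] h]]]] := coatoms_ex t2.
apply: (@moebius_rank2 s c d0 t); rewrite ?nc ?nd0 ?nt //.
- by apply: (occ_at_mono so co); lia.
- by apply: (occ_at_mono so d0o); lia.
- exact: occ_at_le co.
- exact: occ_at_le d0o.
- apply/negP=> dc.
  have sd0 : (s <= d0)%O by apply: (occ_at_mono so d0o); lia.
  by have [] := once_at_mono o sd0 d0o co dc; lia.
- move=> z sz zt; have z1 : 1 < plen z by have := qperm_le_plen sz; lia.
  case: (h z z1 zt) => [||zd]; [by left|by right|].
  have [[|u] [v [_ /= e _]]] := once_at_below o (le_trans sz zd) d1o; lia.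
Qed.

Lemma moebius_second s t : once_at s t 1 2 -> plen t = (plen s).+2 ->
  moebius s t = 1%R.
Proof.
move=> o nt; have [so _] := o; have [s1 _ _ _] := so.
have t2 : 2 < plen t by lia.
have [c [d0 [d1 [[nc nd0 nd1] [co d0o d1o] h]]]] := coatoms_ex t2.
apply: (@moebius_rank2 s c d1 t); rewrite ?nc ?nd1 ?nt //.
- by apply: (occ_at_mono so co); lia.
- by apply: (occ_at_mono so d1o); lia.
- exact: occ_at_le co.
- exact: occ_at_le d1o.
- apply/negP=> dc.
  have sd1 : (s <= d1)%O by apply: (occ_at_mono so d1o); lia.
  by have [] := once_at_mono o sd1 d1o co dc; lia.
- move=> z sz zt; have z1 : 1 < plen z by have := qperm_le_plen sz; lia.
  case: (h z z1 zt) => [|zd|]; [by left| |by right].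
  have [[|u] [v [_ /= e _]]] := once_at_below o (le_trans sz zd) d0o; lia.
Qed.

(** If d0 <= d1, then [once_at_mono] lets position 1 replace position 0 as the first letter of
    d0. *)
Lemma coatoms_not_le s t d0 d1 : once_at s t 2 3 -> 2 < plen t ->
  plen d0 = (plen t).-1 -> occ_at d0 t 0 2 -> occ_at d1 t 1 2 ->
  ~ same_side t 2 (plen t) 0 1 -> ~~ (d0 <= d1)%O.
Proof.
move=> o t2 nd0 d0o d1o ns; have [so _] := o; have [s1 _ xs _] := so.
apply/negP=> dd; apply: ns.
have sd0 : (s <= d0)%O by apply: (occ_at_mono so d0o); lia.
have [_ _ [j [j2 hj]]] := once_at_mono o sd0 d0o d1o dd.
have -> : j = 1 by lia.
by have -> : 2 + plen d0 - 1 = plen t by lia.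
Qed.

Lemma moebius_last s t : once_at s t 2 3 -> plen t = (plen s).+2 ->
  ~ same_side t 2 (plen t) 0 1 -> moebius s t = 1%R.
Proof.
move=> o nt ns; have [so _] := o; have [s1 _ _ _] := so.
have t2 : 2 < plen t by lia.
have [c [d0 [d1 [[nc nd0 nd1] [co d0o d1o] h]]]] := coatoms_ex t2.
apply: (@moebius_rank2 s d1 d0 t); rewrite ?nd0 ?nd1 ?nt //.
- by apply: (occ_at_mono so d1o); lia.
- by apply: (occ_at_mono so d0o); lia.
- exact: occ_at_le d1o.
- exact: occ_at_le d0o.
- exact: (coatoms_not_le o t2).
- move=> z sz zt; have z1 : 1 < plen z by have := qperm_le_plen sz; lia.
  case: (h z z1 zt) => [zc||]; [|by right|by left].
  have [u [[|v] [ouv _ /= e]]] := once_at_below o (le_trans sz zc) co.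
    by lia.
  by case: ouv => -[]; lia.
Qed.

(** Splitting at [c] leaves [d0] and [d1], each of value 1 by [moebius_second], and the pattern [e]
    of [2, n), of value -1. Hence the value -(1 + 1 - 1). *)
Lemma moebius_before_last s t : once_at s t 2 3 -> plen t = (plen s).+3 ->
  ~ same_side t 2 (plen t) 0 1 -> moebius s t = (-1)%R.
Proof.
move=> o nt ns; have [so _] := o; have [s1 _ _ _] := so.
have t2 : 2 < plen t by lia.
have [c [d0 [d1 [[nc nd0 nd1] [co d0o d1o] h]]]] := coatoms_ex t2.
have [e [ne eo]] : exists e, plen e = (plen s).+1 /\ occ_at e t 2 3.
  by apply: occ_at_ex; lia.
have se : (s <= e)%O by apply: (occ_at_mono so eo); lia.
have sd0 : (s <= d0)%O by apply: (occ_at_mono so d0o); lia.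
have sd1 : (s <= d1)%O by apply: (occ_at_mono so d1o); lia.
have dd := coatoms_not_le o t2 nd0 d0o d1o ns.
have mu_d d i : occ_at d t i 2 -> i < 2 -> plen d = (plen t).-1 -> (s <= d)%O ->
    moebius s d = 1%R.
  move=> dO i2 nd sd; have [u [v [ouv eu ev]]] := once_at_below o sd dO.
  apply: moebius_second; last by lia.
  suff [<- <-] : u = 1 /\ v = 2 by [].
  by case: u v eu ev {ouv} => [|u] [|v] /=; lia.
rewrite (@moebius_split_seq s c t [:: e; d0; d1]).
- rewrite !big_cons big_nil (mu_d d0 0) // (mu_d d1 1) // covers_moebius //.
  exact: covers_plen.
- apply: lt_of_plen; last by lia.
  by apply: (occ_at_mono so co); lia.
- by apply: lt_of_plen; [exact: occ_at_le co|lia].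
- rewrite /= !inE !andbT negb_or; apply/andP; split.
    by apply/andP; split; apply: contraTneq isT => E; move: ne; rewrite E; lia.
  by apply: contra dd => /eqP ->.
move=> z; apply/idP/and3P => [|[sz zt zc]].
  have key d i x : occ_at d t i x -> (s <= d)%O -> plen d < plen t ->
      plen t < x + plen d -> [/\ (s <= d)%O, (d < t)%O & ~~ (d <= c)%O].
    move=> dO sd dt dx; split=> //.
      by apply: lt_of_plen => //; exact: occ_at_le dO.
    by apply/negP=> dc; have [] := once_at_mono o sd dO co dc; lia.
  rewrite !inE => /or3P[]/eqP ->.
  - by apply: (key _ _ _ eo); lia.
  - by apply: (key _ _ _ d0o); lia.
  - by apply: (key _ _ _ d1o); lia.
have z1 : 1 < plen z by have := qperm_le_plen sz; lia.
have ltz := qperm_lt_plen zt.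
rewrite !inE; have [pz|pz] := eqVneq (plen z) (plen t).-1.
  have [zc'|zd|zd] := h z z1 zt; first by rewrite zc' in zc.
    by rewrite (le_plen_eq zd) ?eqxx ?orbT //; lia.
  by rewrite (le_plen_eq zd) ?eqxx ?orbT //; lia.
(* Here z has at most [(plen s).+1] letters and its block reaches the end of t, which forces i = 2
   and x = 3. *)
have [i [x [u [v [zo ouv e1 e2]]]]] := once_at_locate o sz (ltW zt).
have [_ ix xz _] := zo; have uv : u < v by case: ouv => -[].
have zx : plen t < x + plen z.
  by rewrite ltnNge; apply: contra zc => zx; apply: (occ_at_mono zo co); lia.
have ze : (z <= e)%O by apply: (occ_at_mono zo eo); lia.
by rewrite (le_plen_eq ze) ?eqxx //; lia.
Qed.

Lemma same_side01E t : 1 < plen t -> same_side t 2 (plen t) 0 1 <->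
  entry t 0 = (entry t 1).+1 \/ entry t 1 = (entry t 0).+1.
Proof.
move=> t1; have t0 := ltnW t1.
have b0 := entry_bound t0; have b1 := entry_bound t1.
have n01 : entry t 0 <> entry t 1 by move/entry_inj; lia.
split=> [h|h k hk].
(* The value just above the smaller of the two would separate them if it stood at a position k >=
   2. *)
- have [|k kt kE] := @entry_surj t (minn (entry t 0) (entry t 1)).+1.
    by lia.
  have [k2|k2] := leqP 2 k; first by have := h k; rewrite kE; lia.
  have : k = 0 \/ k = 1 by lia.
  by case=> ke; move: kE; rewrite ke; lia.
- have nk0 : entry t 0 <> entry t k by move/entry_inj; lia.
  have nk1 : entry t 1 <> entry t k by move/entry_inj; lia.
  by lia.
Qed.

(** All of [c], [d0], [d1] lie above s, and [d0 = d1] exactly when no later letter separates the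
    first two. *)
Lemma covers_threeP s t : once_at s t 2 3 -> plen t = (plen s).+3 ->
  covers_three s t <-> ~ same_side t 2 (plen t) 0 1.
Proof.
move=> o nt; have [so _] := o; have [s1 _ _ _] := so.
have t2 : 2 < plen t by lia.
have [c [d0 [d1 [[nc nd0 nd1] [co d0o d1o] h]]]] := coatoms_ex t2.
have sc : (s <= c)%O by apply: (occ_at_mono so co); lia.
have sd0 : (s <= d0)%O by apply: (occ_at_mono so d0o); lia.
have sd1 : (s <= d1)%O by apply: (occ_at_mono so d1o); lia.
split=> [[x [y [z [uxyz cov]]]] ss|ns].
- have d01 : d0 = d1.
    have d0o' : occ_at d0 t 1 2.
      apply: (occ_at_same_side d0o) => // k hk; apply: ss; lia.
    by apply: (@le_plen_eq d0 d1); [apply: (occ_at_mono d0o' d1o)|]; lia.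
  have sub : {subset [:: x; y; z] <= [:: c; d0]}.
    move=> r /cov[/andP[sr _] [rt no]].
    have r1 : 1 < plen r by have := qperm_le_plen sr; lia.
    have key d i j : occ_at d t i j -> plen d < plen t -> (r <= d)%O -> r = d.
      move=> dO dt rd; apply/eqP; apply: contra_notT no => nrd.
      exists d; rewrite lt_def eq_sym nrd rd /=.
      by apply: lt_of_plen => //; exact: occ_at_le dO.
    rewrite !inE; case: (h r r1 rt) => rd.
    + by rewrite (key _ _ _ co) ?eqxx //; lia.
    + by rewrite (key _ _ _ d0o) ?eqxx ?orbT //; lia.
    + by rewrite d01 (key _ _ _ d1o) ?eqxx ?orbT //; lia.
  by have := uniq_leq_size uxyz sub.
- have dd := coatoms_not_le o t2 nd0 d0o d1o ns.
  have dnc d i : occ_at d t i 2 -> plen d = (plen t).-1 -> (s <= d)%O ->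
      ~~ (d <= c)%O.
    move=> dO nd sd; apply/negP=> dc.
    by have [] := once_at_mono o sd dO co dc; lia.
  exists c, d0, d1; split.
    rewrite /= !inE !andbT negb_or -andbA; apply/and3P; split.
    + by apply: contraNneq (dnc _ _ d0o nd0 sd0) => ->.
    + by apply: contraNneq (dnc _ _ d1o nd1 sd1) => ->.
    + by apply: contraNneq dd => ->.
  have key d i x : occ_at d t i x -> plen d = (plen t).-1 -> (s <= d)%O ->
      (s <= d <= t)%O /\ covers t d.
    move=> dO nd sd; have dt := occ_at_le dO; rewrite sd dt; split=> //.
    by apply: covers_plen => //; lia.
  move=> r; rewrite !inE => /or3P[]/eqP ->.
  + exact: key co _ _.
  + exact: key d0o _ _.
  + exact: key d1o _ _.
Qed.

(** * Patterns of length at most 1 *)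

Lemma le_short (s t : qperm) : plen s <= 1 -> plen s <= plen t -> (s <= t)%O.
Proof.
move=> s1 st; have eqI (j k : 'I_(plen s)) : j = k.
  by apply: val_inj => /=; have := ltn_ord j; have := ltn_ord k; lia.
apply/qc_leP; exists [ffun i => widen_ord st i]; apply/is_occP.
by split=> [j k|j k|j k]; rewrite (eqI j k) ?ltnn //; lia.
Qed.

(** The empty pattern occurs exactly once everywhere. Splitting at the one-letter permutation leaves
    only z of length at least 2. *)
Lemma moebius_empty s t : plen s = 0 -> 1 < plen t -> moebius s t = 0%R.
Proof.
move=> s0; have [k] := ubnP (plen t); elim: k t => // k IH t le_k t1.
pose c := mkqperm (1%g : 'S_1).
have c1 : plen c = 1 by [].
apply: (@moebius_split0 s c).
- by apply: lt_of_plen; [apply: le_short|]; lia.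
- by apply: lt_of_plen; [apply: le_short|]; lia.
- move=> z _ /qperm_lt_plen zt zc; apply: IH; first by lia.
  by rewrite ltnNge; apply: contra zc => z1; apply: le_short => //; lia.
Qed.

(** Every position of t gives an occurrence of the one-letter pattern. *)
Lemma once_plen1 s t : plen s = 1 -> #|occurrences s t| = 1 -> s = t.
Proof.
move=> s1 /eqP/cards1P[f fE].
have eqI (j k : 'I_(plen s)) : j = k.
  by apply: val_inj => /=; have := ltn_ord j; have := ltn_ord k; lia.
have all_i i : [ffun=> i] = f.
  apply/set1P; rewrite -fE inE; apply/is_occP.
  by split=> [j k|j k|j k]; rewrite (eqI j k) ?ltnn //; lia.
have st : (s <= t)%O.
  by apply/qc_leP; exists f; have := set11 f; rewrite -fE inE.
apply: le_plen_eq => //; rewrite leqNgt s1; apply/negP => t1.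
have := all_i (Ordinal (ltnW t1)); rewrite -(all_i (Ordinal t1)).
have s0 : 0 < plen s by rewrite s1.
by move/ffunP/(_ (Ordinal s0)); rewrite !ffunE.
Qed.

(** * From encoded occurrences to the positions p and q *)

Lemma occurrences1_once_at (s t : qperm) f (m1 : 1 < plen s) :
  f \in occurrences s t -> #|occurrences s t| = 1 ->
  once_at s t (f (Ordinal (ltnW m1))) (f (Ordinal m1)).
Proof.
rewrite inE => fo /eqP/cards1P[g gE]; split; first exact: occ_at_is_occ.
have inj h : is_occ (pperm s) (pperm t) h -> h = g.
  by move=> ho; apply/set1P; rewrite -gE inE.
move=> i x /is_occ_occ_at[h ho hE].
by rewrite (inj f fo) -(inj h ho) !hE /= addn0.
Qed.

Lemma uses_positionE m n (s : 'S_m) (t : 'S_n) f (m1 : 1 < m) P :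
  is_occ s t f ->
  uses_position f P = (P == (f (Ordinal (ltnW m1))).+1) ||
    (f (Ordinal m1) < P < f (Ordinal m1) + m).
Proof.
move=> fo; have fq := is_occ_qpos m1 fo.
apply/existsP/orP => [[[[|j] hj]]|[/eqP ->|/andP[qP Pq]]].
- by rewrite fq => /eqP <-; left.
- by rewrite fq /= => /eqP <-; right; lia.
- by exists (Ordinal (ltnW m1)).
- have hj : P - f (Ordinal m1) < m by lia.
  by exists (Ordinal hj); rewrite fq /= qpos_gt0; lia.
Qed.

Lemma consecutive_occE m n (f : {ffun 'I_m -> 'I_n}) (m1 : 1 < m) :
  consecutive_occ f =
    (f (Ordinal m1) == (f (Ordinal (ltnW m1))).+1 :> nat).
Proof.
apply/forallP/eqP => [h|h j].
  by have /forallP/(_ (Ordinal m1)) /= := h (Ordinal (ltnW m1)) => /eqP.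
apply/forallP => k; apply/implyP => /andP[/eqP j0 /eqP k1].
have -> : j = Ordinal (ltnW m1) by apply: val_inj.
have -> : k = Ordinal m1 by apply: val_inj.
exact/eqP.
Qed.

Theorem theorem4p8 (sigma tau : qperm)
    (f : {ffun 'I_(plen sigma) -> 'I_(plen tau)})
    (occ_f : f \in occurrences sigma tau)
    (once : #|occurrences sigma tau| = 1%N) :
  let n := plen tau in
  let case1 := sigma = tau in
  let case2 := covers tau sigma in
  let case3 := rank_itv sigma tau = 2%N /\
    ((uses_position f 1 /\ ~ uses_position f 2 /\ ~ uses_position f n) \/
     (uses_position f 2 /\ ~ uses_position f 1 /\ ~ uses_position f n)) in
  let case4 := rank_itv sigma tau = 2%N /\
    uses_position f n /\ ~ uses_position f 1 /\ ~ uses_position f 2 /\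
    `|(letter tau 1)%:Z - (letter tau 2)%:Z|%R <> 1%R in
  let case5 := rank_itv sigma tau = 3%N /\
    uses_position f (n - 1)%N /\ ~ uses_position f 1 /\
    ~ uses_position f 2 /\ ~ uses_position f n /\
    consecutive_occ f /\ covers_three sigma tau in
  (case1 -> moebius sigma tau = 1%R) /\
  (case2 -> moebius sigma tau = (-1)%R) /\
  (case3 -> moebius sigma tau = 1%R) /\
  (case4 -> moebius sigma tau = 1%R) /\
  (case5 -> moebius sigma tau = (-1)%R) /\
  (~ (case1 \/ case2 \/ case3 \/ case4 \/ case5) -> moebius sigma tau = 0%R).
Proof.
move=> n case1 case2 case3 case4 case5.
split; first by rewrite /case1 => <-; exact: moebius_refl.
split; first exact: covers_moebius.
have fo : is_occ (pperm sigma) (pperm tau) f by move: occ_f; rewrite inE.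
have [m1|m1] := leqP (plen sigma) 1.
  have [st|m0] : sigma = tau \/ plen sigma = 0.
    have [e1|] := eqVneq (plen sigma) 1; last by right; lia.
    by left; exact: once_plen1.
    have r0 : rank_itv sigma tau = 0 by rewrite /rank_itv {1}st subnn.
    rewrite /case3 /case4 /case5 r0; do 3!(split; first by case).
    by case; left.
  have nu P : ~ uses_position f P.
    by case/existsP=> j; have := ltn_ord j; lia.
  split; first by case=> _ [] [/nu].
  split; first by case=> _ [/nu].
  split; first by case=> _ [/nu].
  move=> no; apply: moebius_empty => //; rewrite ltnNge; apply/negP => t1.
  have st : (sigma <= tau)%O by apply/qc_leP; exists f.
  apply: no; have [t0|t0] := posnP (plen tau).
    by left; apply: le_plen_eq; lia.
  by right; left; apply: covers_plen; lia.
have o := occurrences1_once_at m1 occ_f once.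
have uE P := uses_positionE m1 P fo; have cE := consecutive_occE f m1.
(* From here on f enters only through p and q, and the cases become arithmetic. *)
move: o uE cE; move: (f _) (f _) => [q /= _] [p /= _] o uE cE.
have [so _] := o; have [_ pq qm _] := so.
have t1 : 1 < plen tau by lia.
have lE : (`|(letter tau 1)%:Z - (letter tau 2)%:Z|%R = 1%R) <->
    same_side tau 2 (plen tau) 0 1.
  rewrite same_side01E // /letter /=.
  rewrite -[nth 0 _ 0]/(entry tau 0) -[nth 0 _ 1]/(entry tau 1); lia.
rewrite /case1 /case2 /case3 /case4 /case5 /n /rank_itv !uE cE lE.
have st := once_at_le o.
split; last split; last split.
- case=> rk h. have [[p0 q2]|[p1 q2]] : p = 0 /\ q = 2 \/ p = 1 /\ q = 2 by lia.
    by subst p q; apply: moebius_first => //; lia.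
  by subst p q; apply: moebius_second => //; lia.
- case=> rk [h1 [h2 [h3 h4]]]; have [p2 q3] : p = 2 /\ q = 3 by lia.
  by subst p q; apply: moebius_last => //; lia.
- case=> rk [h1 [h2 [h3 [h4 [h5 h6]]]]]; have [p2 q3] : p = 2 /\ q = 3 by lia.
  subst p q; have nt : plen tau = (plen sigma).+3 by lia.
  by apply: moebius_before_last => //; apply/(covers_threeP o nt).
move=> no.
have [gap|gap] := ltnP (q + plen sigma) (plen tau).
  exact: moebius_right_gap o gap.
have rk : (plen sigma).+1 < plen tau.
  rewrite ltnNge; apply/negP => rk; apply: no.
  have [eq_len|ne_len] := leqP (plen tau) (plen sigma).
    by left; exact: le_plen_eq.
  by right; left; apply: covers_plen => //; lia.
have [p0|p0] := posnP p.
  subst p; apply: (moebius_first_gap o); rewrite ltnNge; apply/negP => q2.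
  by apply: no; do 2!right; left; lia.
have [gap'|gap'] := ltnP p.+1 q; first exact: moebius_inner_gap o p0 gap'.
have q1 : q = p.+1 by lia.
subst q; apply: (moebius_deep o).
have [p3|p3] := ltnP 2 p; [by left|right].
have p2 : p = 2.
  have [//|p1] : p = 2 \/ p = 1 by lia.
  by case: no; do 2!right; left; lia.
subst p; split=> //; apply/same_side01E => //.
have [c01|c01] := boolP ((entry tau 0 == (entry tau 1).+1) ||
  (entry tau 1 == (entry tau 0).+1)); first by lia.
have ns : ~ same_side tau 2 (plen tau) 0 1 by move/same_side01E=> /(_ t1); lia.
(* At most one letter follows the block: none gives case (4), one gives case (5). *)
case: no; have [h|h] := leqP (plen tau) (2 + plen sigma).
  by do 3!right; left; do 4!(split; first by lia).
do 4!right; do 5!(split; first by lia); split; first by [].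
by apply/covers_threeP => //; lia.
Qed.
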